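(* Fix $\ell_0>0$, $h_0>0$ and a nonempty compact set $I\subset(0,h_0]$. There exist $U_0=U_0(I,\ell_0,d,t)$ and a function $\varepsilon_{\rm mag}(U,\beta;I)\ge0$ such that, for all $U\ge U_0$, all $\beta>0$ with $\beta J_0(U)\ge\ell_0$, all $L\in2\mathbb N$ and all $h\in I$, \[ \bigl|m^{\rm Hub}_{\Lambda_L,\beta,U}(h)-m^{\rm Heis}_{\Lambda_L,\beta,U}(h)\bigr|\le\varepsilon_{\rm mag}(U,\beta;I), \] and \[ \lim_{U\to\infty}\ \sup_{\beta>0:\ \beta J_0(U)\ge\ell_0}\varepsilon_{\rm mag}(U,\beta;I)=0 . \] (The estimate is uniform in $L$ and $h\in I$.)
   Context: Fix $d\ge 1$ and $t\in\mathbb R\setminus\{0\}$. For $L\in 2\mathbb N$ let $\Lambda_L=(\mathbb Z/L\mathbb Z)^d$ and $\mathscr B_{\Lambda_L}$ the set of unordered nearest-neighbour bonds of the torus, each counted once. Let $\mathcal H_{\Lambda_L}$ be the fermionic Fock space over $\ell^2(\Lambda_L)\otimes\mathbb C^2$ with CAR operators $c_{x\sigma},c^*_{x\sigma}$; $n_{x\sigma}=c^*_{x\sigma}c_{x\sigma}$, $n_x=n_{x\uparrow}+n_{x\downarrow}$, $N_{\Lambda_L}=\sum_xn_x$, $\mathcal H^{\rm hf}_{\Lambda_L}=\ker(N_{\Lambda_L}-|\Lambda_L|)$. Let $D_{\Lambda_L}=\sum_xn_{x\uparrow}n_{x\downarrow}$, $T_{\Lambda_L}=-t\sum_{\{x,y\}\in\mathscr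 B_{\Lambda_L}}\sum_\sigma(c^*_{x\sigma}c_{y\sigma}+c^*_{y\sigma}c_{x\sigma})$, $\eta_x=(-1)^{x_1+\dots+x_d}$, $S^{(3)}_x=\frac12(n_{x\uparrow}-n_{x\downarrow})$, $M_{\Lambda_L}=\sum_x\eta_xS^{(3)}_x$, and $H^{\rm Hub}_{\Lambda_L}(h)=UD_{\Lambda_L}+T_{\Lambda_L}-hM_{\Lambda_L}$ on $\mathcal H^{\rm hf}_{\Lambda_L}$ ($U>0$). The Hubbard Gibbs state is $\omega^{\rm Hub}_{\Lambda_L,\beta,U,h}(O)=\operatorname{Tr}_{\mathcal H^{\rm hf}}(Oe^{-\beta H^{\rm Hub}_{\Lambda_L}(h)})/\operatorname{Tr}_{\mathcal H^{\rm hf}}e^{-\beta H^{\rm Hub}_{\Lambda_L}(h)}$ and $m^{\rm Hub}_{\Lambda_L,\beta,U}(h)=|\Lambda_L|^{-1}\omega^{\rm Hub}_{\Lambda_L,\beta,U,h}(M_{\Lambda_L})$. Spin side: $\mathcal H^{\rm spin}_{\Lambda_L}=\bigotimes_{x}\mathbb C^2$, $S^{(a)}_x$ acts as $\frac12\sigma^{(a)}$ at $x$, $M^{\rm spin}_{\Lambda_L}=\sum_x\eta_xS^{(3)}_x$, $H^{\rm Heis}_{\Lambda_L}(J,h)=J\sum_{\{x,y\}\in\mathscr B_{\Lambda_L}}(\mathbf S_x\cdot\mathbf S_y-\frac14)-hM^{\rm spin}_{\Lambda_L}$, $J_0(U)=4t^2/U$; the Heisenberg Gibbs state $\omega^{\rm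 Heis}_{\Lambda_L,\beta,U,h}$ is the Gibbs state of $H^{\rm Heis}_{\Lambda_L}(J_0(U),h)$ on $\mathcal H^{\rm spin}_{\Lambda_L}$ and $m^{\rm Heis}_{\Lambda_L,\beta,U}(h)=|\Lambda_L|^{-1}\omega^{\rm Heis}_{\Lambda_L,\beta,U,h}(M^{\rm spin}_{\Lambda_L})$. *)

(* Defs.v *)
(* Complex numbers: R[i] from mathcomp-real-closed. *)
From HB Require Import structures.
From mathcomp Require Import all_boot all_order all_algebra.
From mathcomp Require Import all_classical all_reals all_analysis.
From mathcomp Require Import complex.
Set Implicit Arguments. Unset Strict Implicit. Unset Printing Implicit Defensive.
Import Order.TTheory GRing.Theory Num.Theory.
Import numFieldNormedType.Exports.
Local Open Scope ring_scope.

(* ---------- lattice ---------- *)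
(* Sites of the torus (Z/LZ)^d. *)
Notation site d L := {ffun 'I_d -> 'I_L}.

(* x + e_i on the torus *)
Definition site_shift d L (x : site d L) (i : 'I_d) : site d L :=
  [ffun j => if j == i then ordS (x j) else x j].

(* unordered nearest-neighbour bonds, each counted once *)
Definition bonds d L : {set {set site d L}} :=
  [set [set x; site_shift x i] | x : site d L, i : 'I_d].

(* staggered sign eta_x = (-1)^(x_1+...+x_d) *)
Definition eta (R : pzRingType) d L (x : site d L) : R :=
  (-1) ^+ (\sum_(i < d) (x i : nat))%N.

(* ---------- finite-dimensional linear algebra over C = R[i] ---------- *)
Definition mxpow (C : pzRingType) n (A : 'M[C]_n) (k : nat) : 'M[C]_n :=
  iter k (mulmx A) 1%:M.

(* matrix exponential: entrywise limit of the partial sums of the exponential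
   series (a complex sequence converges iff its real and imaginary parts do) *)
Definition expm (R : realType) n (A : 'M[R[i]]_n) : 'M[R[i]]_n :=
  let S := fun k : nat => \sum_(j < k) ((j`!%:R)^-1 : R[i]) *: mxpow A j in
  \matrix_(a, b)
    ((limn (fun k => (complex.Re (S k a b) : R)))%:C
     + 'i%C * (limn (fun k => (complex.Im (S k a b) : R)))%:C)%C.

(* Gibbs expectation  Tr(O e^{-beta H}) / Tr e^{-beta H} *)
Definition gibbs (R : realType) n (beta : R) (H O : 'M[R[i]]_n) : R[i] :=
  \tr (O *m expm (- (beta%:C)%C *: H)) / \tr (expm (- (beta%:C)%C *: H)).

(* ---------- Fock space ---------- *)
(* modes (x, sigma), sigma = true for spin up; occupation-number basis *)
Notation mode d L := (site d L * bool)%type.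
Notation fconf d L := {ffun mode d L -> bool}.
(* half-filled configurations: exactly |Lambda| particles (basis of ker(N-|Lambda|)) *)
Notation hfconf d L := {c : fconf d L | #|[pred m | c m]| == #|{: site d L}| }.
Notation fop R d L := 'M[R[i]]_#|{: fconf d L}|.

(* annihilation operator c_m with Jordan-Wigner sign (modes ordered by enum_rank) *)
Definition cop (R : realType) d L (m : mode d L) : fop R d L :=
  \matrix_(a, b)
    (let ca : fconf d L := enum_val a in let cb : fconf d L := enum_val b in
     if cb m && (ca == [ffun m' => if m' == m then false else cb m'])
     then (-1) ^+ #|[pred m' | (enum_rank m' < enum_rank m)%N && cb m']|
     else 0).

(* creation operator = adjoint (conjugate transpose) *)
Definition cdag (R : realType) d L (m : mode d L) : fop R d L :=
  (map_mx (fun z : R[i] => (z^*)%C) (cop R m))^T.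

Definition nop (R : realType) d L (m : mode d L) : fop R d L :=
  cdag R m *m cop R m.

Definition Dop (R : realType) d L : fop R d L :=
  \sum_(x : site d L) (nop R (x, true) *m nop R (x, false)).

(* T = -t sum_{bonds {x,y}} sum_sigma (c*_x c_y + c*_y c_x) *)
Definition Top (R : realType) d L (t : R) : fop R d L :=
  - (t%:C)%C *: \sum_(b in bonds d L) \sum_(x in b) \sum_(y in b | y != x)
       \sum_(s : bool) (cdag R (x, s) *m cop R (y, s)).

Definition S3op (R : realType) d L (x : site d L) : fop R d L :=
  (2%:R)^-1 *: (nop R (x, true) - nop R (x, false)).

Definition Mop (R : realType) d L : fop R d L :=
  \sum_(x : site d L) (eta R[i] x *: S3op R x).

Definition HubH (R : realType) d L (t U h : R) : fop R d L :=
  (U%:C)%C *: @Dop R d L + @Top R d L t - (h%:C)%C *: @Mop R d L.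

(* compression/restriction of a Fock operator to the half-filled subspace *)
Definition hf_restr (R : realType) d L (A : fop R d L)
  : 'M[R[i]]_#|{: hfconf d L}| :=
  \matrix_(a, b) A (enum_rank (val (enum_val a))) (enum_rank (val (enum_val b))).

Definition m_Hub (R : realType) d L (t beta U h : R) : R[i] :=
  gibbs beta (hf_restr (@HubH R d L t U h)) (hf_restr (@Mop R d L))
  / (#|{: site d L}|%:R).

(* ---------- spin side ---------- *)
(* basis: spin configurations, true = up = (1,0) *)
Notation sconf d L := {ffun site d L -> bool}.
Notation sop R d L := 'M[R[i]]_#|{: sconf d L}|.

Definition sflip d L (s : sconf d L) (x : site d L) : sconf d L :=
  [ffun y => if y == x then ~~ s y else s y].

(* S^(1)_x = sigma^1/2 *)
Definition Sx1 (R : realType) d L (x : site d L) : sop R d L :=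
  \matrix_(a, b) (if enum_val a == sflip (enum_val b : sconf d L) x then (2%:R)^-1 else 0).
(* S^(2)_x = sigma^2/2, sigma^2 |up> = i|down>, sigma^2 |down> = -i|up> *)
Definition Sx2 (R : realType) d L (x : site d L) : sop R d L :=
  \matrix_(a, b) (if enum_val a == sflip (enum_val b : sconf d L) x then
                   (if (enum_val b : sconf d L) x then 'i%C / 2%:R else - 'i%C / 2%:R) else 0).
(* S^(3)_x = sigma^3/2 *)
Definition Sx3 (R : realType) d L (x : site d L) : sop R d L :=
  \matrix_(a, b) (if a == b then (if (enum_val b : sconf d L) x then (2%:R)^-1 else - (2%:R)^-1)
                  else 0).

Definition SdotS (R : realType) d L (x y : site d L) : sop R d L :=
  Sx1 R x *m Sx1 R y + Sx2 R x *m Sx2 R y + Sx3 R x *m Sx3 R y.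

Definition Mspin (R : realType) d L : sop R d L :=
  \sum_(x : site d L) (eta R[i] x *: Sx3 R x).

(* J sum_{bonds {x,y}} (S_x.S_y - 1/4) - h M ; for a bond b = {x,y} the
   ordered double sum over x != y in b counts the (symmetric) term twice,
   hence the factor 1/2 *)
Definition HeisH (R : realType) d L (J h : R) : sop R d L :=
  (J%:C)%C *: \sum_(b in bonds d L) ((2%:R)^-1 *:
      \sum_(x in b) \sum_(y in b | y != x) (SdotS R x y - (4%:R)^-1%:M))
  - (h%:C)%C *: @Mspin R d L.

Definition J0 (R : realType) (t U : R) : R := 4 * t ^+ 2 / U.

Definition m_Heis (R : realType) d L (t beta U h : R) : R[i] :=
  gibbs beta (@HeisH R d L (J0 t U) h) (@Mspin R d L) / (#|{: site d L}|%:R).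

(* Main.v *)
Require Import Defs.
From HB Require Import structures.
From mathcomp Require Import all_boot all_order all_algebra.
From mathcomp Require Import all_classical all_reals all_analysis.
From mathcomp Require Import complex ring lra.
Import Order.TTheory GRing.Theory Num.Theory.
Import numFieldNormedType.Exports.
Local Open Scope ring_scope.
Local Open Scope classical_set_scope.
Local Open Scope sesquilinear_scope.

(* Idea. On the stated domain h is bounded below on I, while J_0(U) = 4t^2/U tends
   to 0 and 1/beta <= J_0(U)/l_0 tends to 0 as well; hence both staggered
   magnetisations saturate at 1/2, and it suffices to bound their defects
   uniformly in L.

   Let H = H_0 - h M with M <= N/2, N being the number of sites. The Gibbs
   variational inequality, tested on the Neel state, gives
     <H> <= <Neel|H|Neel> + ln(dim)/beta,
   where ln(dim) <= 2N. If H_0 >= -bN and <Neel|H_0|Neel> <= bN, then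
   h (N/2 - <M>) <= (2b + 2/beta) N.

   For the Heisenberg model b = d J_0 by counting bonds. For the Hubbard model,
   T connects the singly occupied configurations only to states with a doublon,
   so U D + T >= -16 d^2 J_0 N at half filling: this is a Schur test with the
   weights e^(number of doublons), e = 16 d |t| / U. *)

(** * Gibbs variational inequality for finitely many levels *)

(** The relative entropy of the Gibbs weights with respect to the uniform distribution is
    nonnegative, which gives beta <l> <= ln n - ln Z; keeping one term of Z gives - ln Z <= beta
    l_{i0}. *)
Lemma gibbs_energy_le (R : realType) n (beta : R) (l : 'I_n -> R) (i0 : 'I_n) :
  0 < beta ->
  (\sum_i l i * expR (- beta * l i)) / (\sum_i expR (- beta * l i))
    <= l i0 + ln n%:R / beta.
Proof.
move=> b0; set E := fun i => expR (- beta * l i).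
have E0 i : 0 < E i by apply: expR_gt0.
set Z := \sum_i expR _.
have n0 : 0 < n%:R :> R by rewrite ltr0n; case: n i0 {l E E0 Z} => // -[].
have EZ : E i0 <= Z.
  by rewrite /Z (bigD1 i0) //= lerDl sumr_ge0 // => i _; apply: ltW.
have Z0 : 0 < Z by apply: lt_le_trans EZ.
have lnZ : - beta * l i0 <= ln Z.
  by rewrite -ler_expR lnK ?posrE.
(* This is ln x <= x - 1 at x = Z / (n E_i), multiplied by E_i; the right-hand sides sum to zero. *)
have H i : E i * (ln Z - ln n%:R + beta * l i) <= Z / n%:R - E i.
  have q0 : 0 < Z / (n%:R * E i) by rewrite divr_gt0 ?mulr_gt0.
  have lnE : ln (E i) = - beta * l i by rewrite /E expRK.
  have K : ln Z - (ln n%:R + - beta * l i) <= Z / (n%:R * E i) - 1.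
    have := @le_ln1Dx R (Z / (n%:R * E i) - 1).
    rewrite addrCA subrr addr0 => /(_ _)/wrap[]; first by lra.
    by rewrite ln_div ?posrE ?mulr_gt0 // lnM ?posrE // lnE.
  apply: le_trans (_ : E i * (Z / (n%:R * E i) - 1) <= _).
    by rewrite ler_pM2l //; apply: (le_trans _ K); lra.
  rewrite mulrBr mulr1 lerD2r le_eqVlt; apply/orP; left; apply/eqP; field.
  by rewrite !gt_eqF.
have : \sum_i E i * (ln Z - ln n%:R + beta * l i) <= \sum_i (Z / n%:R - E i).
  by apply: ler_sum => i _; apply: H.
rewrite sumrB sumr_const card_ord -/Z.
under eq_bigr do rewrite mulrDr.
rewrite big_split /= -mulr_suml -/Z -(mulr_natr (Z / _)) divfK ?gt_eqF // subrr.
have -> : \sum_i E i * (beta * l i) = beta * \sum_i l i * E i.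
  by rewrite mulr_sumr; apply: eq_bigr => i _; ring.
move=> K; rewrite ler_pdivrMr // -(ler_pM2l b0) -/E.
have -> : beta * ((l i0 + ln n%:R / beta) * Z) = Z * (beta * l i0 + ln n%:R).
  by field; rewrite gt_eqF.
have : Z * (- beta * l i0) <= Z * ln Z by rewrite ler_pM2l.
lra.
Qed.

(** * Exponential of a unitarily diagonalized matrix *)

Section Spectral.
Variable R : realType.
Local Notation C := R[i].

(** Each entry of a partial sum is a fixed combination of scalar exponential series. The eigenvalues
    being real, [Re] and [Im] act on the coefficients only, which fits the separate limits in
    [expm]. *)
Lemma expm_diagonalizable n (P : 'M[C]_n) (x : 'I_n -> R) : P \is unitarymx ->
  expm (P^t* *m diag_mx (\row_i (x i)%:C%C) *m P)
  = P^t* *m diag_mx (\row_i (expR (x i))%:C%C) *m P.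
Proof.
move=> PU; set A := _ *m _.
have diagE (D : 'rV[C]_n) a b :
    (P^t* *m diag_mx D *m P) a b = \sum_i P^t* a i * P i b * D 0 i.
  rewrite mxE; apply: eq_bigr => i _; rewrite mul_mx_diag !mxE; ring.
have powA j : mxpow A j = P^t* *m diag_mx (\row_i ((x i) ^+ j)%:C%C) *m P.
  elim: j => [|j IH].
    have -> : \row_i ((x i) ^+ 0)%:C%C = const_mx 1 :> 'rV[C]_n.
      by apply/rowP => i; rewrite !mxE expr0.
    rewrite diag_const_mx mulmx1 -invmx_unitary // mulVmx //.
    exact: unitarymx_unit.
  rewrite /mxpow iterS -/(mxpow A j) IH /A.
  rewrite !mulmxA (mulmxtVK _ PU) -[X in X *m P = _]mulmxA mulmx_diag.
  congr (_ *m diag_mx _ *m _); apply/rowP => i; rewrite !mxE.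
  by rewrite exprS rmorphM.
have SE k a b : (\sum_(j < k) ((j`!%:R)^-1 : C) *: mxpow A j) a b
    = \sum_i (P^t* a i * P i b) * (series (exp_coeff (x i)) k)%:C%C.
  rewrite summxE; under eq_bigr do rewrite mxE powA diagE mulr_sumr.
  rewrite exchange_big; apply: eq_bigr => i _ /=.
  rewrite /series /= big_mkord rmorph_sum mulr_sumr; apply: eq_bigr => j _.
  rewrite mxE /exp_coeff /= rmorphM fmorphV rmorph_nat; ring.
have limE (c : 'I_n -> R) : limn (fun k => \sum_i c i * series (exp_coeff (x i)) k)
     = \sum_i c i * expR (x i).
  apply/cvg_lim => //; apply: cvg_big => [|i _]; first exact: add_continuous.
  apply: cvgMl_tmp; exact: is_cvg_series_exp_coeff.
have ReM (z : C) (r : R) : complex.Re (z * r%:C%C) = complex.Re z * r.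
  by case: z => u v /=; rewrite mulr0 subr0.
have ImM (z : C) (r : R) : complex.Im (z * r%:C%C) = complex.Im z * r.
  by case: z => u v /=; rewrite mulr0 add0r.
apply/matrixP => a b; rewrite diagE mxE.
have -> : (fun k => complex.Re ((\sum_(j < k) ((j`!%:R)^-1 : C) *: mxpow A j) a b))
  = (fun k => \sum_i complex.Re (P^t* a i * P i b) * series (exp_coeff (x i)) k).
  apply/funext => k; rewrite SE raddf_sum; apply: eq_bigr => i _; exact: ReM.
have -> : (fun k => complex.Im ((\sum_(j < k) ((j`!%:R)^-1 : C) *: mxpow A j) a b))
  = (fun k => \sum_i complex.Im (P^t* a i * P i b) * series (exp_coeff (x i)) k).
  apply/funext => k; rewrite SE raddf_sum; apply: eq_bigr => i _; exact: ImM.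
rewrite !limE !rmorph_sum mulr_sumr -big_split /=; apply: eq_bigr => i _.
rewrite mxE !rmorphM /= [in RHS](complexE (P^t* a i * P i b)) mulrDl; ring.
Qed.

End Spectral.

(** * Gibbs expectations in an eigenbasis of the Hamiltonian *)

Section GroundState.
Variable R : realType.
Local Notation C := R[i].

Lemma row_form n (P A : 'M[C]_n) i :
  (row i P *m A *m (row i P)^t*) 0 0 = (P *m A *m P^t*) i i.
Proof. by rewrite -row_mul !mxE; apply: eq_bigr => k _; rewrite !mxE. Qed.

Lemma scale_conj_diag n (Q P : 'M[C]_n) (c : C) (D : 'rV[C]_n) :
  c *: (Q *m diag_mx D *m P) = Q *m diag_mx (c *: D) *m P.
Proof. by rewrite scalemxAl scalemxAr -linearZ. Qed.

(** In an eigenbasis of [H] the trace sees only the diagonal [mu] of [M]. The bound - B <= l_i + h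
    mu_i is averaged over the Gibbs weights, and the mean of l_i is controlled by
    [gibbs_energy_le]. *)
Lemma gibbs_order_ge n (beta h B e m : R) (H M : 'M[C]_n) (a0 : 'I_n) :
  0 < beta -> 0 < h -> H \is hermsymmx ->
  (forall v : 'rV_n, - B%:C%C * (v *m v^t*) 0 0
     <= (v *m (H + h%:C%C *: M) *m v^t*) 0 0) ->
  (forall v : 'rV_n, (v *m M *m v^t*) 0 0 <= m%:C%C * (v *m v^t*) 0 0) ->
  H a0 a0 <= e%:C%C ->
  exists g : R, [/\ gibbs beta H M = g%:C%C, g <= m &
    - B - e - ln n%:R / beta <= h * g].
Proof.
move=> b0 h0 Hh formH formM He.
have [PU HE] : spectralmx H \is unitarymx /\
    H = invmx (spectralmx H) *m diag_mx (spectral_diag H) *m spectralmx H.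
  by split; [exact: spectral_unitarymx | exact/orthomx_spectralP/hermitian_normalmx].
have Dreal := hermitian_spectral_diag_real Hh.
move: PU HE Dreal; move: (spectralmx H) (spectral_diag H) => P D PU HE Dreal.
pose l i := complex.Re (D 0 i).
have lE i : D 0 i = (l i)%:C%C by rewrite /l RRe_real //; apply/mxOverP.
rewrite invmx_unitary // in HE.
pose mu i := complex.Re ((P *m M *m P^t*) i i).
have PP i : (row i P *m (row i P)^t*) 0 0 = 1.
  have := row_form _ P 1%:M i; rewrite !mulmx1 => ->.
  by rewrite (unitarymxP _) // mxE eqxx.
(* In the order of [R[i]] comparable numbers have equal imaginary parts, so [formM] also makes these
   diagonal entries real. *)
have muE i : (P *m M *m P^t*) i i = (mu i)%:C%C /\ mu i <= m.
  have := formM (row i P); rewrite row_form PP mulr1 /mu.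
  case: (_ i i) => u v; rewrite lecE /= => /andP[/eqP <-] ->.
  by split.
have PHP i : (P *m H *m P^t*) i i = (l i)%:C%C.
  rewrite {1}HE !mulmxA (unitarymxP _) // mul1mx mulmxtVK // mxE eqxx.
  by rewrite mulr1n lE.
have lmu i : - B <= l i + h * mu i.
  have := formH (row i P).
  rewrite row_form PP mulr1 mulmxDr mulmxDl mxE PHP -scalemxAr -scalemxAl mxE.
  by rewrite (muE i).1 -rmorphM -rmorphD -rmorphN lecR.
(* [H a0 a0] is an average of the eigenvalues with weights |P_{i a0}|^2, so some eigenvalue is at
   most [e]; it is the trial level. *)
have [i0 li0] : exists i0, l i0 <= e.
  apply/not_existsP => /= K.
  suff : e%:C%C < H a0 a0 by move/(le_lt_trans He); rewrite ltxx.
  have HaE : H a0 a0 = \sum_i `|P i a0| ^+ 2 * (l i)%:C%C.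
    rewrite {1}HE mxE; apply: eq_bigr => i _; rewrite mul_mx_diag !mxE lE normCK.
    ring.
  have sum1 : \sum_i `|P i a0| ^+ 2 = 1.
    have : (P^t* *m P) a0 a0 = 1.
      by rewrite -invmx_unitary // mulVmx ?unitarymx_unit // mxE eqxx.
    by rewrite mxE => <-; apply: eq_bigr => i _; rewrite !mxE normCK mulrC.
  have Kl i : e < l i by rewrite ltNge; apply/negP/K.
  rewrite HaE -[e%:C%C]mul1r -sum1 mulr_suml.
  have [j Pj] : exists j, P j a0 != 0.
    apply/not_existsP => /= P0; move: sum1; rewrite big1 => [/esym/eqP|i _].
      by rewrite oner_eq0.
    by have /negP := P0 i; rewrite negbK => /eqP ->; rewrite normr0 expr0n.
  rewrite (bigD1 j) //= [ltRHS](bigD1 j) //= ltr_leD //.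
    by rewrite ltr_pM2l ?ltcR // exprn_gt0 // normr_gt0.
  by apply: ler_sum => i _; rewrite ler_wpM2l ?lecR ?exprn_ge0 // ltW.
pose E i := expR (- beta * l i).
have expE : expm (- (beta%:C)%C *: H) = P^t* *m diag_mx (\row_i (E i)%:C%C) *m P.
  have -> : - (beta%:C)%C *: H
      = P^t* *m diag_mx (\row_i (- beta * l i)%:C%C) *m P.
    suff -> : \row_i (- beta * l i)%:C%C = - (beta%:C)%C *: D.
      by rewrite {1}HE scale_conj_diag.
    by apply/rowP => i; rewrite !mxE lE -rmorphN -rmorphM.
  exact: expm_diagonalizable.
have Z0 : 0 < \sum_i E i.
  by rewrite (bigD1 i0) //= ltr_pwDl ?expR_gt0 // sumr_ge0 // => i _; apply: expR_ge0.
exists ((\sum_i mu i * E i) / (\sum_i E i)); split.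
- have trE (A : 'M[C]_n) : \tr (A *m (P^t* *m diag_mx (\row_i (E i)%:C%C) *m P))
      = \sum_i (P *m A *m P^t*) i i * (E i)%:C%C.
    move: (P^t*) => Q; rewrite mulmxA mxtrace_mulC !mulmxA /mxtrace.
    by apply: eq_bigr => i _; rewrite mul_mx_diag !mxE.
  rewrite /gibbs expE -[in X in _ / X](mul1mx (_ *m P)) !trE.
  rewrite rmorphM fmorphV !rmorph_sum; congr (_ / _).
    by apply: eq_bigr => i _; rewrite (muE i).1 rmorphM.
  by apply: eq_bigr => i _; rewrite mulmx1 (unitarymxP _) // mxE eqxx mul1r.
- rewrite ler_pdivrMr // mulr_sumr; apply: ler_sum => i _.
  by rewrite ler_wpM2r ?expR_ge0 // (muE i).2.
- have := @gibbs_energy_le R n beta l i0 b0.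
  have : \sum_i (- B) * E i <= \sum_i (l i * E i + h * (mu i * E i)).
    apply: ler_sum => i _; rewrite mulrA -mulrDl ler_wpM2r ?expR_ge0 //.
  rewrite -mulr_sumr big_split /= -mulr_sumr.
  rewrite -/E => K1 K2.
  have : - B <= (\sum_i l i * E i) / (\sum_i E i) + h * ((\sum_i mu i * E i) / \sum_i E i).
    by rewrite mulrA -mulrDl ler_pdivlMr.
  lra.
Qed.

End GroundState.

(** * Quadratic forms and the weighted Schur test *)

Section Forms.
Variable R : realType.
Local Notation C := R[i].

Lemma form_diag n (x : 'rV[C]_n) (v : 'rV[C]_n) :
  (v *m diag_mx x *m v^t*) 0 0 = \sum_a x 0 a * `|v 0 a| ^+ 2.
Proof.
rewrite mxE; apply: eq_bigr => a _; rewrite mul_mx_diag !mxE normCK; ring.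
Qed.

Lemma form1 n (v : 'rV[C]_n) : (v *m v^t*) 0 0 = \sum_a `|v 0 a| ^+ 2.
Proof. by rewrite mxE; apply: eq_bigr => a _; rewrite !mxE normCK. Qed.

Lemma form_real n (A : 'M[C]_n) (v : 'rV[C]_n) : A^t* = A ->
  (v *m A *m v^t*) 0 0 \is Num.real.
Proof.
move=> AA; apply/CrealP.
have -> : ((v *m A *m v^t*) 0 0)^* = ((v *m A *m v^t*)^t*) 0 0 by rewrite !mxE.
by rewrite !trmx_mul !map_mxM AA trmxCK mulmxA.
Qed.

(** AM-GM splits |v_a| |v_b| with ratio w_b / w_a; the symmetry of |A_ab| makes the two halves equal
    after exchanging the summations. *)
Lemma norm_form_le n (A : 'M[C]_n) (v : 'rV[C]_n) (w : 'I_n -> R) :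
  A^t* = A -> (forall a, 0 < w a) ->
  `|(v *m A *m v^t*) 0 0|
    <= \sum_a (\sum_b `|A a b| * (w b / w a)%:C%C) * `|v 0 a| ^+ 2.
Proof.
move=> AA w0.
have Asym a b : `|A a b| = `|A b a| by rewrite -{1}AA !mxE norm_conjC.
rewrite mxE.
have -> : \sum_b (v *m A) 0 b * (v^t*) b 0
    = \sum_b \sum_a v 0 a * A a b * (v 0 b)^*.
  by apply: eq_bigr => b _; rewrite !mxE mulr_suml.
have amgm (x y r : C) : x \is Num.real -> y \is Num.real -> 0 < r ->
    x * y <= x ^+ 2 * r / 2 + y ^+ 2 / r / 2.
  move=> xr yr r0; rewrite -subr_ge0.
  have -> : x ^+ 2 * r / 2 + y ^+ 2 / r / 2 - x * y = (x - y / r) ^+ 2 * (r / 2).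
    by field; rewrite gt_eqF.
  apply: mulr_ge0; last by rewrite divr_ge0 ?ltW.
  by rewrite real_exprn_even_ge0 // rpredB // rpred_div // gtr0_real.
pose f a b := `|A a b| * (w b / w a)%:C%C * `|v 0 a| ^+ 2 / 2.
apply: le_trans (_ : \sum_b \sum_a (f a b + f b a) <= _).
  apply: le_trans (ler_norm_sum _ _ _) _; apply: ler_sum => b _.
  apply: le_trans (ler_norm_sum _ _ _) _; apply: ler_sum => a _.
  rewrite !normrM norm_conjC /f (Asym b a).
  have r0 : 0 < (w b / w a)%:C%C :> C by rewrite ltcR divr_gt0.
  have -> : (w a / w b)%:C%C = ((w b / w a)%:C%C)^-1 :> C.
    by rewrite -fmorphV invf_div.
  have := amgm _ _ _ (normr_real (v 0 a)) (normr_real (v 0 b)) r0.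
  move/(ler_wpM2l (normr_ge0 (A a b))); congr (_ <= _); ring.
rewrite [leLHS](_ : _ = \sum_a \sum_b f a b + \sum_a \sum_b f a b); last first.
  rewrite [X in _ = X + _]exchange_big -big_split; apply: eq_bigr => b _.
  by rewrite -big_split.
rewrite -big_split le_eqVlt; apply/orP; left; apply/eqP.
apply: eq_bigr => a _; rewrite mulr_suml -big_split; apply: eq_bigr => b _ /=.
by rewrite /f -splitr.
Qed.

(* Schur test with weights [w], absorbing the off-diagonal part into [d]. *)
Lemma form_ge n (A : 'M[C]_n) (d w : 'I_n -> R) (B : R) :
  A^t* = A -> (forall a, 0 < w a) ->
  (forall a, \sum_b `|A a b| * (w b / w a)%:C%C <= (d a + B)%:C%C) ->
  forall v : 'rV[C]_n, - B%:C%C * (v *m v^t*) 0 0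
    <= (v *m (diag_mx (\row_i (d i)%:C%C) + A) *m v^t*) 0 0.
Proof.
move=> AA w0 H v; rewrite mulmxDr mulmxDl [leRHS]mxE form_diag.
under eq_bigr do rewrite mxE.
rewrite form1.
have := norm_form_le _ _ v _ AA w0.
have := form_real _ _ v AA; move: (_ 0 0) => q qr qle.
have : - (\sum_a (d a + B)%:C%C * `|v 0 a| ^+ 2) <= q.
  rewrite lerNl; apply: le_trans (_ : `|q| <= _).
    by rewrite -normrN real_ler_norm // rpredN.
  apply: (le_trans qle); apply: ler_sum => a _.
  by rewrite ler_wpM2r ?exprn_ge0.
move/(lerD (lexx (\sum_a (d a)%:C%C * `|v 0 a| ^+ 2))) => K.
apply: le_trans K; rewrite -sumrB mulr_sumr le_eqVlt; apply/orP; left; apply/eqP.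
apply: eq_bigr => a _; rewrite rmorphD /=; ring.
Qed.

End Forms.

(** * The saturation bound common to both models *)

Section NearSaturation.
Variable R : realType.
Local Notation C := R[i].

(** The base 4 is the number of fermionic states per site; ln 4 = 2 ln 2 <= 2 bounds the entropy per
    site. *)
Lemma ln_le_of_le_exp4 (n N : nat) : (0 < n)%N -> (n <= 4 ^ N)%N ->
  ln n%:R <= 2 * N%:R :> R.
Proof.
move=> n0 nN; apply: le_trans (_ : ln ((4 ^ N)%:R) <= _).
  by rewrite ler_ln ?posrE ?ltr0n ?expn_gt0 // ler_nat.
rewrite natrX lnXn ?ltr0n // -(mulr_natr (ln _)) ler_wpM2r //.
have -> : 4%:R = 2 * 2 :> R by rewrite -natrM.
rewrite lnM ?posrE //.
have := @le_ln1Dx R 1; rewrite (_ : 1 + 1 = 2) // => /(_ _)/wrap[]; first by lra.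
lra.
Qed.

(** In the applications [d] and [A] make up H_0, [w] holds the Schur weights and [a0] is the Neel
    state. The same [b] bounds H_0 from below and its Neel energy from above, hence [2 * b]; the
    term [2 / beta] is the entropy. *)
Lemma gibbs_near_saturation n (N : nat) (beta h b : R) (d w mu : 'I_n -> R)
    (A H M : 'M[C]_n) (a0 : 'I_n) :
  0 < beta -> 0 < h -> (0 < N)%N -> (n <= 4 ^ N)%N ->
  M = diag_mx (\row_i (mu i)%:C%C) ->
  H = diag_mx (\row_i (d i)%:C%C) + A - h%:C%C *: M ->
  A^t* = A -> (forall a, 0 < w a) ->
  (forall a, \sum_c `|A a c| * (w c / w a)%:C%C <= (d a + b * N%:R)%:C%C) ->
  (forall a, mu a <= N%:R / 2) -> mu a0 = N%:R / 2 ->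
  (d a0)%:C%C + A a0 a0 <= (b * N%:R)%:C%C ->
  exists2 g : R, gibbs beta H M / N%:R = g%:C%C &
    1 / 2 - (2 * b + 2 / beta) / h <= g <= 1 / 2.
Proof.
move=> b0 h0 N0 nN ME HE AA w0 Aw mule mu0 Ha0.
have NR : 0 < N%:R :> R by rewrite ltr0n.
have n0 : (0 < n)%N by apply: leq_ltn_trans (ltn_ord a0).
have diagt (x : 'I_n -> R) : (diag_mx (\row_i (x i)%:C%C) : 'M[C]_n)^t*
    = diag_mx (\row_i (x i)%:C%C).
  apply/matrixP => i j; rewrite !mxE eq_sym.
  by case: eqP => [->|]; rewrite ?mulr1n ?mulr0n ?conjC0 //; apply: conjc_real.
have Hh : H \is hermsymmx.
  apply/is_hermitianmxP; rewrite expr0 scale1r HE ME.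
  rewrite !linearB !linearD /= !map_mxB !map_mxD AA diagt; congr (_ - _).
  rewrite linearZ /= map_mxZ diagt; congr (_ *: _).
  exact/esym/conjc_real.
have formH (v : 'rV[C]_n) : - (b * N%:R)%:C%C * (v *m v^t*) 0 0
    <= (v *m (H + h%:C%C *: M) *m v^t*) 0 0.
  by rewrite HE subrK; apply: (form_ge _ _ _ d w).
have formM (v : 'rV[C]_n) :
    (v *m M *m v^t*) 0 0 <= (N%:R / 2)%:C%C * (v *m v^t*) 0 0.
  rewrite ME form_diag form1 mulr_sumr; apply: ler_sum => a _.
  by rewrite mxE ler_wpM2r ?exprn_ge0 // lecR.
have Haa : H a0 a0 <= (b * N%:R - h * (N%:R / 2))%:C%C.
  by rewrite HE ME !mxE eqxx !mulr1n mu0 rmorphB (rmorphM _ h) lerB.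
have [g [gE gle gge]] := gibbs_order_ge _ _ _ _ _ _ _ _ _ _ b0 h0 Hh formH formM Haa.
exists (g / N%:R); first by rewrite gE rmorphM fmorphV rmorph_nat.
rewrite ler_pdivrMr // [X in _ && (_ <= X)]mulrC mulrA mulr1 gle andbT.
rewrite ler_pdivlMr // -(ler_pM2l h0); apply: le_trans gge.
have lnb : ln n%:R / beta <= 2 * N%:R / beta.
  by rewrite ler_pM2r ?invr_gt0 // ln_le_of_le_exp4.
have -> : h * ((1 / 2 - (2 * b + 2 / beta) / h) * N%:R)
    = h * (N%:R / 2) - 2 * b * N%:R - 2 * N%:R / beta.
  by field; rewrite !gt_eqF.
lra.
Qed.

End NearSaturation.

(** * Counting nearest-neighbour bonds *)

Section Bonds.
Variables d L : nat.

Lemma site_shift_inj (i : 'I_d) : injective (fun x : site d L => site_shift x i).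
Proof.
move=> x y /ffunP xy; apply/ffunP => j; have := xy j; rewrite !ffunE.
by case: eqP => // _; apply: ordS_inj.
Qed.

(** The pairs (x, i) cover every bond, but not always once: at side 2 both ends shift to each other.
    Nonnegativity turns the overcounting into an upper bound. *)
Lemma sum_bonds_le (T : numDomainType) (F : site d L -> site d L -> T) :
  (forall x y, 0 <= F x y) ->
  \sum_(b in bonds d L) \sum_(x in b) \sum_(y in b | y != x) F x y
    <= \sum_(x : site d L) \sum_(i < d) (F x (site_shift x i) + F (site_shift x i) x).
Proof.
move=> F0; pose G (b : {set site d L}) := \sum_(x in b) \sum_(y in b | y != x) F x y.
have G0 b : 0 <= G b by apply: sumr_ge0 => x _; apply: sumr_ge0.
have G2 (x y : site d L) : G [set x; y]%SET <= F x y + F y x.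
  (* For coinciding ends, as on a torus of side 1, the inner sum is empty. *)
  rewrite /G; have [<-|xy] := eqVneq x y.
    rewrite big1 => [|u]; first by rewrite addr_ge0.
    rewrite finset.setUid inE => /eqP ->.
    by rewrite big1 // => v; rewrite inE => /andP[->].
  rewrite big_setU1 ?inE //= big_set1 !big_mkcondr /=.
  rewrite !big_setU1 ?inE //= !big_set1 !eqxx /=.
  by rewrite xy eq_sym xy add0r addr0.
pose f (p : site d L * 'I_d) := [set p.1; site_shift p.1 p.2]%SET.
rewrite pair_big /=.
apply: le_trans (_ : \sum_p G (f p) <= _); last first.
  by apply: ler_sum => p _; apply: G2.
rewrite [leRHS](partition_big f xpredT) //= -/(G _) [leLHS]big_mkcond /=.
apply: ler_sum => b _; case: ifP => [|_]; last by apply: sumr_ge0.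
case/imset2P => x i _ _ bE.
rewrite (bigD1 (x, i)) /=; last by rewrite bE.
rewrite (_ : f (x, i) = b); last by rewrite bE.
by rewrite lerDl sumr_ge0.
Qed.

Lemma sum_bonds_cst_le (R : realType) (c : R[i]) : 0 <= c ->
  \sum_(b in bonds d L) \sum_(x in b) \sum_(y in b | y != x) c
    <= c * (2 * d * #|{: site d L}|)%:R.
Proof.
move=> c0; apply: le_trans (sum_bonds_le _ (fun _ _ => c) _) _ => //.
rewrite !sumr_const card_ord -mulr2n -!mulrnA mulr_natr.
by rewrite mulnA (@eq_card _ xpredT {: site d L}).
Qed.

End Bonds.

(** * Weighted absolute row sums of matrices *)

Section RowSums.
Variable R : realType.
Local Notation C := R[i].

(** For [W b] the ratio w_b / w_a at a fixed row [a], this is the left side of the Schur test. *)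
Definition row_sum n (W : 'I_n -> C) (A : 'M[C]_n) (a : 'I_n) : C :=
  \sum_b `|A a b| * W b.

Lemma row_sum_sum n (W : 'I_n -> C) (I : finType) (P : pred I) (F : I -> 'M[C]_n) a :
  (forall b, 0 <= W b) ->
  row_sum n W (\sum_(i | P i) F i) a <= \sum_(i | P i) row_sum n W (F i) a.
Proof.
move=> W0; rewrite exchange_big; apply: ler_sum => b _ /=.
by rewrite summxE -mulr_suml ler_wpM2r // ler_norm_sum.
Qed.

Lemma row_sumD n (W : 'I_n -> C) (A B : 'M[C]_n) a :
  (forall b, 0 <= W b) ->
  row_sum n W (A + B) a <= row_sum n W A a + row_sum n W B a.
Proof.
move=> W0; rewrite -big_split; apply: ler_sum => b _ /=.
by rewrite mxE -mulrDl ler_wpM2r // ler_normD.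
Qed.

Lemma row_sumZ n (W : 'I_n -> C) c (A : 'M[C]_n) a :
  row_sum n W (c *: A) a = `|c| * row_sum n W A a.
Proof.
by rewrite mulr_sumr; apply: eq_bigr => b _; rewrite mxE normrM mulrA.
Qed.

Lemma row_sumN n (W : 'I_n -> C) (A : 'M[C]_n) a :
  row_sum n W (- A) a = row_sum n W A a.
Proof. by apply: eq_bigr => b _; rewrite mxE normrN. Qed.

(** With unit weights the largest row sum is the operator norm for the sup norm, hence
    submultiplicative. *)
Lemma row_sumM n (c e : C) (A B : 'M[C]_n) :
  0 <= e ->
  (forall a, row_sum n (fun=> 1) A a <= c) -> (forall a, row_sum n (fun=> 1) B a <= e) ->
  forall a, row_sum n (fun=> 1) (A *m B) a <= c * e.
Proof.
move=> e0 Ac Be a; apply: le_trans (_ : \sum_k `|A a k| * row_sum n (fun=> 1) B k <= _).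
  under [leRHS]eq_bigr do rewrite mulr_sumr.
  rewrite exchange_big; apply: ler_sum => b _ /=; rewrite mulr1 mxE.
  apply: le_trans (ler_norm_sum _ _ _) _; apply: ler_sum => k _.
  by rewrite normrM mulr1.
apply: le_trans (_ : (\sum_k `|A a k| * 1) * e <= _); last by rewrite ler_wpM2r ?Ac.
rewrite mulr_suml; apply: ler_sum => k _; rewrite mulr1.
by rewrite ler_wpM2l.
Qed.

(** Spin components and single hops have at most one nonzero entry per row. *)
Lemma row_sum_single n (W : 'I_n -> C) (A : 'M[C]_n) a c : 0 <= c ->
  (forall b b', A a b != 0 -> A a b' != 0 -> b = b') ->
  (forall b, A a b != 0 -> `|A a b| * W b <= c) ->
  row_sum n W A a <= c.
Proof.
move=> c0 uniqb Ac; case: (pickP (fun b => A a b != 0)) => [b Ab|A0].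
  rewrite /row_sum (bigD1 b) //= big1 ?addr0 ?Ac // => b' b'b.
  have [->|Ab'] := eqVneq (A a b') 0; first by rewrite normr0 mul0r.
  by rewrite (uniqb _ _ Ab' Ab) eqxx in b'b.
by rewrite /row_sum big1 // => b _; have /eqP -> := A0 b; rewrite normr0 mul0r.
Qed.

(** Lets the row-sum bound behind the lower bound on H_0 also serve for the Neel energy. *)
Lemma diag_le_row_sum n (W : 'I_n -> C) (A : 'M[C]_n) a :
  A^t* = A -> (forall b, 0 <= W b) -> W a = 1 -> A a a <= row_sum n W A a.
Proof.
move=> AA W0 Wa; have Ar : A a a \is Num.real.
  by apply/CrealP; rewrite -[in RHS]AA !mxE.
apply: le_trans (real_ler_norm Ar) _.
rewrite /row_sum (bigD1 a) //= Wa mulr1 lerDl sumr_ge0 // => b _.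
by rewrite mulr_ge0.
Qed.

Lemma adj_bond_sum (S : finType) (b : {set S}) n (F : S -> S -> 'M[C]_n) :
  (forall x y, (F x y)^t* = F y x) ->
  (\sum_(x in b) \sum_(y in b | y != x) F x y)^t*
    = \sum_(x in b) \sum_(y in b | y != x) F x y.
Proof.
move=> FF; rewrite !raddf_sum.
under eq_bigr do rewrite !raddf_sum big_mkcondr.
rewrite exchange_big /=; apply: eq_bigr => x _.
rewrite [RHS]big_mkcondr; apply: eq_bigr => y _ /=.
by rewrite FF eq_sym.
Qed.

End RowSums.

(** * Saturation in the Heisenberg model *)

Section Heisenberg.
Variables (R : realType) (d L : nat).
Local Notation C := R[i].
Local Notation N := #|{: site d L}|.

Lemma sflipK (s : sconf d L) x : sflip (sflip s x) x = s.
Proof. by apply/ffunP => y; rewrite !ffunE; case: eqP => // _; rewrite negbK. Qed.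

Lemma sflip_sym (s s' : sconf d L) x : (s == sflip s' x) = (s' == sflip s x).
Proof. by apply/eqP/eqP => ->; rewrite sflipK. Qed.

Lemma adj_Sx1 (x : site d L) : (Sx1 R x)^t* = Sx1 R x.
Proof.
apply/matrixP => a b; rewrite !mxE sflip_sym; case: ifP => _.
  by rewrite fmorphV rmorph_nat.
by rewrite conjC0.
Qed.

Lemma adj_Sx2 (x : site d L) : (Sx2 R x)^t* = Sx2 R x.
Proof.
have conji : (('i%C : C)^*)%R = - 'i%C by apply/eqP; rewrite eq_complex /= oppr0 !eqxx.
apply/matrixP => a b; rewrite !mxE sflip_sym; case: eqP => [->|_]; last first.
  by rewrite conjC0.
rewrite ffunE eqxx; case: (_ x) => /=;
  by rewrite rmorphM fmorphV rmorph_nat ?rmorphN /= conji ?opprK.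
Qed.

Lemma adj_Sx3 (x : site d L) : (Sx3 R x)^t* = Sx3 R x.
Proof.
apply/matrixP => a b; rewrite !mxE eq_sym; case: eqP => [->|_]; last first.
  by rewrite conjC0.
by case: (_ x); rewrite ?rmorphN fmorphV rmorph_nat.
Qed.

Lemma adj_SdotS (x y : site d L) :
  (SdotS R x y - (4%:R)^-1%:M)^t* = SdotS R y x - (4%:R)^-1%:M.
Proof.
rewrite linearB !linearD /= map_mxB !map_mxD !trmx_mul !map_mxM.
rewrite !adj_Sx1 !adj_Sx2 !adj_Sx3 tr_scalar_mx map_scalar_mx.
by congr (_ - _%:M); rewrite fmorphV rmorph_nat.
Qed.

Lemma row_sum_Sx1 (x : site d L) a : row_sum R _ (fun=> 1) (Sx1 R x) a <= 2^-1.
Proof.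
apply: row_sum_single => [|b b'|b]; rewrite ?invr_ge0 // !mxE.
  case: ifP => [/eqP ab _|_]; last by rewrite eqxx.
  case: ifP => [/eqP ab' _|_]; last by rewrite eqxx.
  by apply: enum_val_inj; rewrite -(sflipK (enum_val b) x) -ab ab' sflipK.
by case: ifP => _ _; rewrite mulr1 ?normr0 ?invr_ge0 // ger0_norm ?invr_ge0.
Qed.

Lemma row_sum_Sx2 (x : site d L) a : row_sum R _ (fun=> 1) (Sx2 R x) a <= 2^-1.
Proof.
have normi : `|'i%C : C| = 1 by rewrite normc_def /= expr0n expr1n add0r sqrtr1.
apply: row_sum_single => [|b b'|b]; rewrite ?invr_ge0 // !mxE.
  case: ifP => [/eqP ab _|_]; last by rewrite eqxx.
  case: ifP => [/eqP ab' _|_]; last by rewrite eqxx.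
  by apply: enum_val_inj; rewrite -(sflipK (enum_val b) x) -ab ab' sflipK.
case: ifP => _ _; rewrite mulr1 ?normr0 ?invr_ge0 //.
by case: ifP => _; rewrite normrM ?normrN normi mul1r ger0_norm ?invr_ge0.
Qed.

Lemma row_sum_Sx3 (x : site d L) a : row_sum R _ (fun=> 1) (Sx3 R x) a <= 2^-1.
Proof.
apply: row_sum_single => [|b b'|b]; rewrite ?invr_ge0 // !mxE.
  case: ifP => [/eqP <- _|_]; last by rewrite eqxx.
  by case: ifP => [/eqP|]; rewrite ?eqxx.
case: ifP => _ _; rewrite mulr1 ?normr0 ?invr_ge0 //.
by case: ifP => _; rewrite ?normrN ger0_norm ?invr_ge0.
Qed.

Lemma row_sum_SdotS (x y : site d L) a :
  row_sum R _ (fun=> 1) (SdotS R x y - (4%:R)^-1%:M) a <= 1.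
Proof.
have h0 : 0 <= 2^-1 :> C by rewrite invr_ge0.
(* Each of the three spin products contributes 1/4, and so does the constant. *)
rewrite [leRHS](_ : 1 = (2^-1 * 2^-1 + 2^-1 * 2^-1 + 2^-1 * 2^-1) + 4^-1); last first.
  by field.
apply: le_trans (row_sumD _ _ _ _ _ _ _) _ => //; apply: lerD.
  apply: le_trans (row_sumD _ _ _ _ _ _ _) _ => //; apply: lerD.
    apply: le_trans (row_sumD _ _ _ _ _ _ _) _ => //; apply: lerD.
      exact: (row_sumM _ _ _ _ _ _ h0 (row_sum_Sx1 x) (row_sum_Sx1 y)).
    exact: (row_sumM _ _ _ _ _ _ h0 (row_sum_Sx2 x) (row_sum_Sx2 y)).
  exact: (row_sumM _ _ _ _ _ _ h0 (row_sum_Sx3 x) (row_sum_Sx3 y)).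
rewrite row_sumN; apply: row_sum_single => [|b b'|b]; rewrite ?invr_ge0 // !mxE.
  have [<- _|_] := eqVneq a b; last by rewrite mulr0n eqxx.
  by have [->|] := eqVneq a b'; rewrite ?mulr0n ?eqxx.
by case: (a == b) => _; rewrite mulr1 ?mulr0n ?normr0 ?mulr1n ?ger0_norm ?invr_ge0.
Qed.

Definition neel_spin : sconf d L :=
  [ffun x : site d L => ~~ odd (\sum_(i < d) (x i : nat))].

Lemma etaE (K : pzRingType) (x : site d L) : Defs.eta K x = (-1) ^+ (~~ neel_spin x).
Proof. by rewrite /Defs.eta -signr_odd ffunE negbK. Qed.

Lemma sign_half (e s : bool) :
  (-1) ^+ (~~ e) * (if s then 2^-1 else - 2^-1) = if e == s then 2^-1 else - 2^-1 :> R.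
Proof. by case: e; case: s; rewrite ?mul1r ?mulN1r ?opprK. Qed.

Lemma m_Heis_near_saturation (t U beta h : R) :
  0 < beta -> 0 < h -> 0 <= J0 t U -> (0 < L)%N ->
  exists2 g : R, @m_Heis R d L t beta U h = g%:C%C &
    1 / 2 - (2 * (J0 t U * d%:R) + 2 / beta) / h <= g <= 1 / 2.
Proof.
move=> b0 h0 J0ge L0.
pose sg (s : bool) : R := if s then 2^-1 else - 2^-1.
pose mu (a : 'I_#|{: sconf d L}|) : R :=
  \sum_x Defs.eta R x * sg ((enum_val a : sconf d L) x).
pose A : sop R d L := ((J0 t U)%:C)%C *: \sum_(b in bonds d L) ((2%:R)^-1 *:
      \sum_(x in b) \sum_(y in b | y != x) (SdotS R x y - (4%:R)^-1%:M)).
have AA : A^t* = A.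
  rewrite /A linearZ /= map_mxZ; congr (_ *: _); first exact: conjc_real.
  rewrite !raddf_sum; apply: eq_bigr => b _ /=.
  rewrite linearZ /= map_mxZ adj_bond_sum; last exact: adj_SdotS.
  by rewrite fmorphV rmorph_nat.
have Arow a : row_sum R _ (fun=> 1) A a <= (J0 t U * d%:R * N%:R)%:C%C.
  rewrite row_sumZ ger0_norm ?ler0c // -mulrA (rmorphM _ (J0 t U)) ler_wpM2l ?ler0c //.
  apply: le_trans (row_sum_sum _ _ _ _ _ _ _ _) _ => //.
  apply: le_trans (_ : \sum_(b in bonds d L) \sum_(x in b) \sum_(y in b | y != x) 2^-1 <= _).
    apply: ler_sum => b _; rewrite row_sumZ ger0_norm ?invr_ge0 //.
    have -> : \sum_(x in b) \sum_(y in b | y != x) 2^-1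
       = 2^-1 * \sum_(x in b) \sum_(y in b | y != x) 1 :> C.
      rewrite mulr_sumr; apply: eq_bigr => x _; rewrite mulr_sumr.
      by apply: eq_bigr => y _; rewrite mulr1.
    rewrite ler_wpM2l ?invr_ge0 //.
    apply: le_trans (row_sum_sum _ _ _ _ _ _ _ _) _ => //; apply: ler_sum => x _.
    apply: le_trans (row_sum_sum _ _ _ _ _ _ _ _) _ => //; apply: ler_sum => y _.
    exact: row_sum_SdotS.
  (* The 1/2 per ordered pair cancels the 2 in the count 2 d N. *)
  apply: le_trans (sum_bonds_cst_le _ _ _ _ _) _; first by rewrite invr_ge0.
  by rewrite -natrM rmorph_nat -mulnA natrM mulKf ?pnatr_eq0.
have W1 a c : `|A a c| * (1 / 1 : R)%:C%C = `|A a c| * 1 by rewrite divr1.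
(* The whole exchange term is taken as [A], with zero diagonal part and constant Schur weights. *)
apply: (gibbs_near_saturation _ _ _ _ _ _ (fun=> 0) (fun=> 1) mu A _ _
  (enum_rank neel_spin)) => //.
- by rewrite card_ffun card_ord expn_gt0 L0.
- by rewrite card_ffun card_bool leq_exp2r // card_ffun card_ord expn_gt0 L0.
- apply/matrixP => a b; rewrite summxE !mxE.
  have [->|ab] := eqVneq a b; last first.
    by rewrite mulr0n big1 // => x _; rewrite !mxE (negbTE ab) mulr0.
  rewrite mulr1n /mu rmorph_sum; apply: eq_bigr => x _; rewrite !mxE eqxx.
  rewrite rmorphM rmorphXn rmorphN1 /sg; congr (_ * _).
  by case: ifP => _; rewrite ?rmorphN fmorphV rmorph_nat.
- rewrite /HeisH -/A (_ : diag_mx _ = 0) ?add0r //.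
  by apply/matrixP => a b; rewrite !mxE mul0rn.
- move=> a; rewrite add0r; apply: le_trans (Arow a).
  by under eq_bigr do rewrite W1.
- move=> a; rewrite /mu -[N]card_ord; apply: le_trans (_ : \sum_(x : site d L) 2^-1 <= _).
    by apply: ler_sum => x _; rewrite etaE sign_half; case: ifP => _ //;
      rewrite -subr_ge0 opprK addr_ge0 ?invr_ge0.
  by rewrite sumr_const card_ord mulr_natl.
- rewrite /mu enum_rankK.
  rewrite (eq_bigr (fun=> 2^-1)) ?sumr_const ?mulr_natl // => x _.
  by rewrite etaE sign_half eqxx.
- rewrite add0r; apply: le_trans (Arow _).
  exact: diag_le_row_sum.
Qed.

End Heisenberg.

(** * Hops, occupation numbers and doublons in Fock space *)

Section Fock.
Variables (R : realType) (d L : nat).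
Local Notation C := R[i].
Local Notation N := #|{: site d L}|.
Implicit Types (c : fconf d L) (m : mode d L).

Definition unocc m c : fconf d L := [ffun m' => if m' == m then false else c m'].

Definition jw_sign m c : C :=
  (-1) ^+ #|[pred m' | (enum_rank m' < enum_rank m)%N && c m']|.

Lemma copE m a b : cop R m a b =
  if enum_val b m && (enum_val a == unocc m (enum_val b))
  then jw_sign m (enum_val b) else 0.
Proof. by rewrite mxE. Qed.

Lemma unocc_inj m c c' : c m -> c' m -> unocc m c = unocc m c' -> c = c'.
Proof.
move=> cm c'm /ffunP e; apply/ffunP => m'; have := e m'; rewrite !ffunE.
by case: eqP => [->|] //; rewrite cm c'm.
Qed.

(** The product passes through a single intermediate configuration, that of [a] with mode [m]
    emptied. *)
Lemma hopE m m' a b : (cdag R m *m cop R m') a b =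
  if [&& (enum_val a : fconf d L) m, (enum_val b : fconf d L) m' &
      unocc m (enum_val a) == unocc m' (enum_val b)]
  then jw_sign m (enum_val a) * jw_sign m' (enum_val b) else 0.
Proof.
rewrite mxE (bigD1 (enum_rank (unocc m (enum_val a)))) //= big1 => [|k kP].
  rewrite addr0 /cdag mxE mxE !copE enum_rankK eqxx andbT.
  case: (enum_val a m); last by rewrite conjc0 mul0r.
  case: (enum_val b m'); last by rewrite mulr0.
  rewrite /=; case: eqP => _; last by rewrite mulr0.
  by rewrite /jw_sign rmorphXn rmorphN1.
rewrite /cdag mxE mxE !copE; case: andP => [[_ /eqP kE]|_]; last by rewrite conjc0 mul0r.
by rewrite -kE enum_valK eqxx in kP.
Qed.

Lemma norm_hop_le m m' a b : `|(cdag R m *m cop R m') a b| <= 1.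
Proof.
rewrite hopE; case: ifP => _; last by rewrite normr0.
by rewrite normrM !normrX normrN1 !expr1n mulr1.
Qed.

Lemma nopE m : nop R m = diag_mx (\row_a ((enum_val a : fconf d L) m)%:R).
Proof.
apply/matrixP => a b; rewrite hopE !mxE; have [<-|ab] := eqVneq a b.
  rewrite eqxx andbT mulr1n andbb; case: (enum_val a m) => //.
  by rewrite /jw_sign -exprD addnn -signr_odd odd_double.
rewrite mulr0n; case: ifP => // /and3P[am bm /eqP/(unocc_inj _ _ _ am bm)/enum_val_inj].
by move/eqP: ab.
Qed.

Lemma adj_hop m m' : (cdag R m *m cop R m')^t* = cdag R m' *m cop R m.
Proof.
have cdagE k : cdag R k = (cop R k)^t* by apply/matrixP => a b; rewrite !mxE.
by rewrite !cdagE trmx_mul map_mxM trmxCK.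
Qed.

Definition doublons c : nat := \sum_(x : site d L) (c (x, true) && c (x, false)).

(** These are the empty and the doubly occupied sites. *)
Definition unpolarized c (x : site d L) : bool := c (x, true) == c (x, false).

Lemma card_modes c :
  #|[pred m | c m]| = (\sum_(x : site d L) (c (x, true) + c (x, false)))%N.
Proof.
rewrite -sum1_card big_mkcond /= (eq_bigr (fun m => nat_of_bool (c (m.1, m.2)))); last first.
  by move=> [x s] _; rewrite inE; case: (c _).
rewrite -(pair_bigA _ (fun x s => nat_of_bool (c (x, s)))) /=.
by apply: eq_bigr => x _; rewrite big_bool.
Qed.

(** At half filling there are as many holes as doublons. Sitewise, [unpolarized] + n_x = 1 + 2
    [doubly occupied]; summing, N cancels. *)
Lemma sum_unpolarized c : #|[pred m | c m]| = N ->
  (\sum_(x : site d L) unpolarized c x = 2 * doublons c)%N.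
Proof.
rewrite card_modes => cN; apply/eqP.
rewrite -(eqn_add2r (\sum_(x : site d L) (c (x, true) + c (x, false)))%N).
rewrite {2}cN -big_split /= -sum1_card /doublons big_distrr -big_split /=.
by apply/eqP; apply: eq_bigr => x _; rewrite /unpolarized; case: (c _); case: (c _).
Qed.

(** From [c'] to [c] a spin [s] moves from [y] to [x], so the opposite spins at the two sites decide
    both the change in doublons and which ends are unpolarized in [c]. *)
Lemma hop_doublons x y s c c' : x != y -> c (x, s) -> c' (y, s) ->
  unocc (x, s) c = unocc (y, s) c' ->
  [/\ (doublons c + c (y, ~~ s) = doublons c' + c (x, ~~ s))%N,
      unpolarized c x = c (x, ~~ s) & unpolarized c y = ~~ c (y, ~~ s)].
Proof.
move=> xy cx c'y /ffunP e.
have c'x : c' (x, s) = false.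
  by have := e (x, s); rewrite !ffunE eqxx xpair_eqE (negbTE xy).
have cy : c (y, s) = false.
  by have := e (y, s); rewrite !ffunE eqxx xpair_eqE eq_sym (negbTE xy).
have eN z : c (z, ~~ s) = c' (z, ~~ s).
  by have := e (z, ~~ s); rewrite !ffunE !xpair_eqE; case: (s); rewrite ?andbF.
have ez z u : z != x -> z != y -> c (z, u) = c' (z, u).
  by move=> zx zy; have := e (z, u); rewrite !ffunE !xpair_eqE (negbTE zx) (negbTE zy).
have dE (f : fconf d L) z : f (z, true) && f (z, false) = f (z, s) && f (z, ~~ s).
  by case: (s) => //=; rewrite andbC.
split.
- rewrite /doublons (bigD1 x) //= (bigD1 y) 1?eq_sym //=.
  rewrite [in RHS](bigD1 x) //= [in RHS](bigD1 y) 1?eq_sym //=.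
  rewrite !dE cx c'x cy c'y -!eN /=.
  rewrite [in RHS](eq_bigr (fun z => nat_of_bool (c (z, true) && c (z, false)))); last first.
    by move=> z /andP[zx zy]; rewrite !ez.
  by rewrite !add0n addnC addnCA addnC.
- by rewrite /unpolarized; move: cx; case: (s) => /= ->; case: (c _).
- by rewrite /unpolarized; move: cy; case: (s) => /= ->; case: (c _).
Qed.

End Fock.

(** * Row sums of the hopping term at half filling *)

Section Hubbard.
Variables (R : realType) (d L : nat).
Local Notation C := R[i].
Local Notation N := #|{: site d L}|.

Definition hf_conf (a : 'I_#|{: hfconf d L}|) : fconf d L := val (enum_val a).

Lemma hf_conf_inj : injective hf_conf.
Proof. by move=> a b /val_inj/enum_val_inj. Qed.

Lemma hf_restrE (A : fop R d L) :
  hf_restr A = mxsub (enum_rank \o hf_conf) (enum_rank \o hf_conf) A.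
Proof. by apply/matrixP => a b; rewrite !mxE. Qed.

Definition hop (x y : site d L) : fop R d L :=
  \sum_(s : bool) (cdag R (x, s) *m cop R (y, s)).

Lemma adj_hf_Top t : (hf_restr (@Top R d L t))^t* = hf_restr (@Top R d L t).
Proof.
have TT : (@Top R d L t)^t* = @Top R d L t.
  rewrite /Top linearZ /= map_mxZ; congr (_ *: _).
    by rewrite rmorphN; congr (- _); exact: conjc_real.
  rewrite !raddf_sum; apply: eq_bigr => b _ /=.
  apply: (adj_bond_sum _ _ _ _ hop) => x y.
  by rewrite /hop !raddf_sum; apply: eq_bigr => s _; apply: adj_hop.
by rewrite -[in RHS]TT; apply/matrixP => a b; rewrite !mxE.
Qed.

(* A hop between singly occupied sites creates a doublon, hence the weight
   [e]; any other hop is counted by the unpolarized sites of [a]. *)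
Lemma row_sum_hop (e : R) (x y : site d L) s a : 0 < e -> x != y ->
  row_sum R _ (fun b => (e ^+ doublons d L (hf_conf b)
                         / e ^+ doublons d L (hf_conf a))%:C%C)
     (hf_restr (cdag R (x, s) *m cop R (y, s))) a
  <= (e + (unpolarized d L (hf_conf a) x + unpolarized d L (hf_conf a) y)%:R / e)%:C%C.
Proof.
move=> e0 xy; have e0' := ltW e0; have c0 : 0 <= (e + (unpolarized d L (hf_conf a) x
    + unpolarized d L (hf_conf a) y)%:R / e)%:C%C :> C.
  by rewrite ler0c addr_ge0 ?divr_ge0.
have nz b : hf_restr (cdag R (x, s) *m cop R (y, s)) a b != 0 ->
    [/\ hf_conf a (x, s), hf_conf b (y, s)
      & unocc d L (x, s) (hf_conf a) = unocc d L (y, s) (hf_conf b)].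
  rewrite mxE hopE !enum_rankK -!/(hf_conf _); case: ifP; last by rewrite eqxx.
  by case/and3P => ? ? /eqP.
apply: row_sum_single => // [b b'|b] /nz[ax byy abE].
  case/nz=> _ b'y ab'E; apply: hf_conf_inj.
  by apply: (unocc_inj _ _ (y, s)) => //; rewrite -abE.
have W0 : 0 <= (e ^+ doublons d L (hf_conf b) / e ^+ doublons d L (hf_conf a))%:C%C :> C.
  by rewrite ler0c divr_ge0 ?exprn_ge0.
apply: le_trans (_ : 1 * (e ^+ doublons d L (hf_conf b)
    / e ^+ doublons d L (hf_conf a))%:C%C <= _).
  by rewrite ler_wpM2r // mxE norm_hop_le.
have [dE -> ->] := hop_doublons _ _ _ _ _ _ _ xy ax byy abE.
rewrite mul1r lecR ler_pdivrMr ?exprn_gt0 //.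
have [p0 ei0] : 0 <= e ^+ doublons d L (hf_conf a) /\ 0 <= e^-1.
  by rewrite exprn_ge0 ?invr_ge0.
(* Needed for the hops that conserve the doublon number: their weight ratio is 1 and exactly one end
   is unpolarized in [a]. *)
have e2 : 1 <= e + e^-1.
  have [e1|/ltW e1] := leP 1 e; first by rewrite -[1]addr0 lerD.
  by rewrite -[1]add0r lerD ?invf_ge1 // ltW.
(* From [a] to [b], in order: a doublon moves, a doublon-hole pair annihilates, a pair is created, a
   hole moves. *)
move: dE p0; case: (hf_conf a (x, ~~ s)); case: (hf_conf a (y, ~~ s)) => /=.
- move/addIn <- => p0; rewrite addn0 mul1r -[leLHS]mul1r ler_wpM2r //.
- rewrite addn0 addn1 => -> _; rewrite exprS mulrA ler_peMl ?exprn_ge0 //.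
  by rewrite mulrDl -mulrA mulVf ?gt_eqF // mulr1 ler_wpDl ?mulr_ge0 ?ler1n.
- rewrite addn0 addn1 => <- p0; rewrite exprS mul0r addr0 lexx //.
- rewrite !addn0 => <- p0; rewrite mul1r -[leLHS]mul1r ler_wpM2r //.
Qed.

(** The 4 counts two spins and two orders per bond. Either end of the bonds in one direction runs
    over all sites and sees 2D unpolarized ones, D being the number of doublons, whence 4 (2D + 2D)
    = 16D. *)
Lemma row_sum_Top (t e : R) a : 0 < e ->
  row_sum R _ (fun b => (e ^+ doublons d L (hf_conf b)
                         / e ^+ doublons d L (hf_conf a))%:C%C)
     (hf_restr (@Top R d L t)) a
  <= (`|t| * (4 * d%:R * N%:R * e + 16 * d%:R * (doublons d L (hf_conf a))%:R / e))%:C%C.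
Proof.
move=> e0; have e0' := ltW e0; set W := (X in row_sum _ _ X _ _); set q := unpolarized d L (hf_conf a).
have W0 b : 0 <= W b by rewrite ler0c divr_ge0 ?exprn_ge0.
pose F x y : C := ((e + (q x + q y)%:R / e) *+ 2)%:C%C.
have F0 x y : 0 <= F x y by rewrite ler0c mulrn_wge0 // addr_ge0 ?divr_ge0.
have normt : `|- (t%:C)%C| = (`|t|)%:C%C :> C.
  by rewrite normrN normc_def /= expr0n addr0 sqrtr_sqr.
rewrite /Top hf_restrE linearZ /= row_sumZ normt rmorphM ler_wpM2l ?ler0c //.
rewrite raddf_sum; apply: le_trans (row_sum_sum _ _ _ _ _ _ _ W0) _.
apply: le_trans (_ : \sum_(b in bonds d L) \sum_(x in b) \sum_(y in b | y != x) F x y <= _).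
  apply: ler_sum => b _; rewrite raddf_sum.
  apply: le_trans (row_sum_sum _ _ _ _ _ _ _ W0) _; apply: ler_sum => x _.
  rewrite raddf_sum; apply: le_trans (row_sum_sum _ _ _ _ _ _ _ W0) _.
  apply: ler_sum => y /andP[_ yx]; rewrite raddf_sum.
  apply: le_trans (row_sum_sum _ _ _ _ _ _ _ W0) _.
  rewrite /F -card_bool -sumr_const rmorph_sum; apply: ler_sum => s _ /=.
  by rewrite -hf_restrE; apply: row_sum_hop; rewrite // eq_sym.
apply: le_trans (sum_bonds_le _ _ _ _ F0) _.
have sq : \sum_(x : site d L) (q x)%:R = 2 * (doublons d L (hf_conf a))%:R :> R.
  rewrite -natr_sum sum_unpolarized ?natrM //.
  by apply/eqP; exact: (valP (enum_val a)).
have -> : \sum_(x : site d L) \sum_(i < d) (F x (site_shift x i) + F (site_shift x i) x)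
    = (\sum_(x : site d L) \sum_(i < d) (4 * e + 4 / e * (q x)%:R + 4 / e * (q (site_shift x i))%:R))%:C%C.
  rewrite rmorph_sum; apply: eq_bigr => x _; rewrite rmorph_sum; apply: eq_bigr => i _.
  rewrite -rmorphD /=; congr (_%:C)%C; rewrite !natrD; field.
  by rewrite gt_eqF.
rewrite lecR exchange_big /= (eq_bigr (fun=> 4 * N%:R * e + 16 * (doublons d L (hf_conf a))%:R / e)) => [|i _].
  by rewrite sumr_const card_ord -mulr_natl le_eqVlt; apply/orP; left; apply/eqP; ring.
rewrite !big_split /= -!mulr_sumr sumr_const sq.
have -> : \sum_(x : site d L) (q (site_shift x i))%:R
    = 2 * (doublons d L (hf_conf a))%:R :> R.
  by rewrite -sq [RHS](reindex_inj (site_shift_inj d L i)).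
rewrite -[in LHS]mulr_natl; ring.
Qed.

End Hubbard.

(** * Saturation in the Hubbard model *)

Section HubbardOrder.
Variables (R : realType) (d L : nat).
Local Notation C := R[i].
Local Notation N := #|{: site d L}|.

Lemma enum_rank_hf_conf_eq a b :
  (enum_rank (hf_conf d L a) == enum_rank (hf_conf d L b)) = (a == b).
Proof. by rewrite (inj_eq enum_rank_inj) (inj_eq (hf_conf_inj d L)). Qed.

Lemma hf_restr_Dop :
  hf_restr (@Dop R d L) = diag_mx (\row_a (doublons d L (hf_conf d L a))%:R).
Proof.
apply/matrixP => a b; rewrite !mxE summxE natr_sum -sumrMnl; apply: eq_bigr => x _.
rewrite !nopE mulmx_diag !mxE -!/(hf_conf d L _) enum_rank_hf_conf_eq enum_rankK.
by rewrite -natrM mulnb.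
Qed.

Lemma hf_restr_Mop :
  hf_restr (@Mop R d L) = diag_mx (\row_a (\sum_x Defs.eta R x *
    (((hf_conf d L a (x, true))%:R - (hf_conf d L a (x, false))%:R) / 2))%:C%C).
Proof.
apply/matrixP => a b; rewrite !mxE summxE rmorph_sum -sumrMnl; apply: eq_bigr => x _.
rewrite /S3op !nopE !mxE -!/(hf_conf d L _) enum_rank_hf_conf_eq enum_rankK.
rewrite rmorphM rmorphXn rmorphN1 rmorphM rmorphB fmorphV !rmorph_nat.
by case: (a == b); rewrite ?mulr0n ?mulr1n ?subrr ?mulr0 // [_^-1 * _]mulrC.
Qed.

Lemma hf_restr_lin (u v : C) (A B K : fop R d L) :
  hf_restr (u *: A + B - v *: K) = u *: hf_restr A + hf_restr B - v *: hf_restr K.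
Proof. by apply/matrixP => a b; rewrite !mxE. Qed.

Lemma staggered_le_half (e u v : bool) :
  (-1) ^+ (~~ e) * ((u%:R - v%:R) / 2) <= 2^-1 :> R.
Proof. by case: e; case: u; case: v => /=; rewrite ?expr0 ?expr1; lra. Qed.

Lemma staggered_eq_half (e : bool) :
  (-1) ^+ (~~ e) * (((true == e)%:R - (false == e)%:R) / 2) = 2^-1 :> R.
Proof. by case: e => /=; rewrite ?expr0 ?expr1; lra. Qed.

Definition neel_fock : fconf d L := [ffun m => m.2 == neel_spin d L m.1].

Lemma neel_fockE x s : neel_fock (x, s) = (s == neel_spin d L x).
Proof. by rewrite ffunE. Qed.

Lemma neel_fock_half_filled : #|[pred m | neel_fock m]| == N.
Proof.
rewrite card_modes -sum1_card; apply/eqP; apply: eq_bigr => x _.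
by rewrite !neel_fockE; case: (neel_spin d L x).
Qed.

Lemma doublons_neel : doublons d L neel_fock = 0%N.
Proof.
by rewrite /doublons big1 // => x _; rewrite !neel_fockE; case: (neel_spin d L x).
Qed.

Lemma m_Hub_near_saturation (t U beta h : R) :
  t != 0 -> 0 < U -> 0 < beta -> 0 < h -> (0 < d)%N -> (0 < L)%N ->
  exists2 g : R, @m_Hub R d L t beta U h = g%:C%C &
    1 / 2 - (2 * (J0 t U * (16 * d%:R ^+ 2)) + 2 / beta) / h <= g <= 1 / 2.
Proof.
move=> t0 U0 b0 h0 d0 L0.
have nt : 0 < `|t| by rewrite normr_gt0.
have dR : 0 < d%:R :> R by rewrite ltr0n.
(* With this [e] the doublon part of the row-sum bound is exactly U times the number of doublons,
   absorbed by U D; the rest is 64 d^2 t^2 N / U = 16 d^2 J_0 N. *)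
pose e : R := 16 * d%:R * `|t| / U.
have e0 : 0 < e by rewrite divr_gt0 ?mulr_gt0.
pose a0 : 'I_#|{: hfconf d L}| := enum_rank (exist _ neel_fock neel_fock_half_filled).
have a0E : hf_conf d L a0 = neel_fock by rewrite /hf_conf enum_rankK.
have wE a : U * (doublons d L (hf_conf d L a))%:R + J0 t U * (16 * d%:R ^+ 2) * N%:R
    = `|t| * (4 * d%:R * N%:R * e + 16 * d%:R * (doublons d L (hf_conf d L a))%:R / e).
  rewrite /e /J0 -(real_normK (num_real t)); field.
  by rewrite !gt_eqF.
have rowT a := row_sum_Top R d L t e a e0.
apply: (gibbs_near_saturation _ _ _ _ _ _
  (fun a => U * (doublons d L (hf_conf d L a))%:R)
  (fun a => e ^+ doublons d L (hf_conf d L a)) _ (hf_restr (@Top R d L t)) _ _ a0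
  b0 h0 _ _ hf_restr_Mop) => //.
- by rewrite card_ffun card_ord expn_gt0 L0.
(* The half-filled basis is part of the Fock basis, of size 2^(2N) = 4^N. *)
- rewrite card_sig; apply: leq_trans (max_card _) _.
  by rewrite card_ffun card_bool card_prod card_bool mulnC expnM.
- rewrite hf_restr_lin hf_restr_Dop.
  congr (_ + _ - _); apply/matrixP => a b; rewrite !mxE.
  case: (a == b); rewrite ?mulr0n ?mulr1n ?mulr0 //.
  by rewrite rmorphM rmorph_nat.
- exact: adj_hf_Top.
- by move=> a; rewrite exprn_gt0.
- by move=> a; rewrite wE; apply: rowT.
- move=> a; apply: le_trans (_ : \sum_(x : site d L) 2^-1 <= _).
    apply: ler_sum => x _; rewrite etaE.
    exact: staggered_le_half.
  by rewrite sumr_const mulr_natl.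
- rewrite a0E (eq_bigr (fun=> 2^-1)) ?sumr_const ?mulr_natl // => x _.
  by rewrite etaE !neel_fockE staggered_eq_half.
(* The Neel state has no doublon, so only the remainder 16 d^2 J_0 N survives. *)
- have := rowT a0; rewrite -wE a0E doublons_neel mulr0 add0r => rowa0.
  rewrite add0r; apply: le_trans rowa0; apply: diag_le_row_sum.
  + exact: adj_hf_Top.
  + by move=> b; rewrite ler0c divr_ge0 ?exprn_ge0 ?ltW.
  + by rewrite a0E doublons_neel expr0 divr1.
Qed.

End HubbardOrder.

(** * Comparison of the magnetisations and the limit of large U *)

Theorem theorem1p2 (R : realType) (d : nat) (hd : (1 <= d)%N)
  (t : R) (ht : t != 0) (l0 h0 : R) (hl0 : 0 < l0) (hh0 : 0 < h0)
  (I : set R) (hIne : I !=set0) (hIc : compact I)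
  (hIsub : I `<=` [set x : R | 0 < x <= h0]) :
  exists U0 : R, exists eps : R -> R -> R,
    (forall U beta : R, 0 <= eps U beta) /\
    (forall U beta : R, U0 <= U -> 0 < beta -> l0 <= beta * J0 t U ->
       forall (k : nat) (h : R), I h ->
         `| @m_Hub R d (k.+1).*2 t beta U h - @m_Heis R d (k.+1).*2 t beta U h |
           <= ((eps U beta)%:C)%C) /\
    ((fun U : R => ereal_sup
        [set (eps U beta)%:E | beta in [set beta : R | 0 < beta /\ l0 <= beta * J0 t U]])
       @ +oo --> (0 : \bar R)%E).
Proof.
(* The least field in [I] is positive by compactness and makes the bounds uniform in [h]. *)
have [hm Ihm hmP] := compact_EVT_min (f := @idfun R) hIne hIc
  (continuous_subspaceT (fun x => cvg_id)).
have hm0 : 0 < hm by have /andP[] := hIsub _ (set_mem Ihm).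
have t2 : 0 < t ^+ 2 by rewrite exprn_even_gt0.
have dR : 1 <= d%:R :> R by rewrite ler1n.
(* The first term is twice the Hubbard constant 16 d^2; the second comes from 2 / beta <= (2 / l_0)
   J_0. *)
pose c : R := 32 * d%:R ^+ 2 + 2 / l0.
have [l0' hm0' t2'] : [/\ 0 <= l0, 0 <= hm & 0 <= t ^+ 2] by rewrite !ltW.
have c0 : 0 <= c by rewrite /c addr_ge0 ?(mulr_ge0, invr_ge0) ?exprn_ge0.
pose K : R := 4 * t ^+ 2 * c / hm.
have K0 : 0 <= K by apply: divr_ge0 => //; apply: mulr_ge0 => //; apply: mulr_ge0.
(* For U > 0 the error is J_0 c / hm; the absolute value keeps it nonnegative for all U, and U_0 = 1
   ensures U > 0. *)
exists 1, (fun U _ => K / `|U|); split; [|split].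
- by move=> U _; rewrite divr_ge0.
- move=> U beta U1 b0 lb k h Ih.
  have U0 : 0 < U by apply: lt_le_trans U1.
  have Jpos : 0 < J0 t U by rewrite divr_gt0 // mulr_gt0.
  have hmh : hm <= h by apply: hmP; rewrite inE.
  have h0' : 0 < h by apply: lt_le_trans hmh.
  have L0 : (0 < (k.+1).*2)%N by rewrite double_gt0.
  have [g1 -> /andP[g1l g1u]] :=
    m_Hub_near_saturation R d _ t U beta h ht U0 b0 h0' hd L0.
  have [g2 -> /andP[g2l g2u]] :=
    m_Heis_near_saturation R d _ t U beta h b0 h0' (ltW Jpos) L0.
  have bJ : 2 / beta <= 2 / l0 * J0 t U.
    rewrite -mulrA ler_pM2l // -[leLHS]mul1r ler_pdivrMr // -mulrA ler_pdivlMl //.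
    by rewrite mulr1 mulrC.
  have KE : K / `|U| = J0 t U * c / hm.
    by rewrite /K /J0 gtr0_norm //; field; rewrite !gt_eqF.
  (* Used with s = 16 d^2 for Hubbard and s = d for Heisenberg, where d <= 16 d^2 as d >= 1. *)
  have bound (s : R) : 0 <= s -> s <= 16 * d%:R ^+ 2 ->
      (2 * (J0 t U * s) + 2 / beta) / h <= K / `|U|.
    move=> s0 sle; rewrite KE; apply: ler_pM.
    - have [Jge bge] : 0 <= J0 t U /\ 0 <= beta by rewrite !ltW.
      apply: addr_ge0; last exact: divr_ge0.
      by apply: mulr_ge0 => //; apply: mulr_ge0.
    - by rewrite invr_ge0 ltW.
    - have : J0 t U * s <= J0 t U * (16 * d%:R ^+ 2) by rewrite ler_pM2l.
      rewrite /c; lra.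
    - by rewrite lef_pV2 ?posrE.
  have B1 := bound _ (mulr_ge0 (ler0n _ 16) (exprn_ge0 2 (ler0n _ d))) (lexx _).
  have B2 : (2 * (J0 t U * d%:R) + 2 / beta) / h <= K / `|U|.
    by apply: bound => //; nra.
  (* Both magnetisations lie between 1/2 minus the error and 1/2. *)
  rewrite -rmorphB normc_def /= expr0n addr0 sqrtr_sqr lecR ler_norml.
  apply/andP; split; lra.
- apply: (@cvg_trans _ ((fun U : R => (K / `|U|)%:E) @ +oo)).
    apply: near_eq_cvg; near=> U.
    have U0 : 0 < U by near: U; exact: nbhs_pinfty_gt.
    have Jpos : 0 < J0 t U by rewrite divr_gt0 // mulr_gt0.
    apply/esym/eqP; rewrite eq_le; apply/andP; split.
      by apply: ub_ereal_sup => _ [beta _ <-].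
    (* The error is constant in beta, so the supremum equals it once the index set is nonempty; beta
       = l_0 / J_0 is a member. *)
    apply: ereal_sup_ubound; exists (l0 / J0 t U) => //.
    by split; [exact: divr_gt0 | rewrite divfK ?gt_eqF].
  apply: cvg_EFin; first by near=> U.
  apply/cvgrPdist_lt => e e0; near=> U.
  have U0 : 0 < U by near: U; exact: nbhs_pinfty_gt.
  rewrite /= sub0r normrN (gtr0_norm U0) ger0_norm; last exact: divr_ge0 (ltW _).
  rewrite ltr_pdivrMr //.
  rewrite mulrC -ltr_pdivrMr //.
  near: U; apply: nbhs_pinfty_gt; exact: num_real.
Unshelve. all: by end_near.
Qed.
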